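(* Let $\phi: L^1_+\to L^1_+$ be an allocation rule. Then $\phi$ satisfies feasibility, scale invariance, independence of a future income, consistency and continuity if and only if $\phi$ is a geometric rule, i.e. if and only if there is a function $\lambda:\mathbb{Z}\to[0,1]$ such that for each $r\in L^1_+$ and each $i\in\mathbb{Z}$, $$\phi_i(r)=\lambda_i\sum_{j\in\mathbb{Z}:\, j\le i}\ \prod_{k=j}^{i-1}(1-\lambda_k)\,r_j .$$
   Context: $L^1$ is the set of functions $r:\mathbb{Z}\to\mathbb{R}$, $i\mapsto r_i$, with $\sum_{i\in\mathbb{Z}}|r_i|<+\infty$, and $L^1_+$ is the subset of those with $r_i\ge 0$ for all $i$. An allocation rule is any function $\phi:L^1_+\to L^1_+$; $\phi_i(r)$ denotes the $i$-th coordinate of $\phi(r)$. Empty products equal $1$. Axioms for an allocation rule $\phi$: Feasibility: for each $r\in L^1_+$, $\sum_{i\in\mathbb{Z}}\phi_i(r)\le\sum_{i\in\mathbb{Z}}r_i$. Scale invariance: for each $r\in L^1_+$ and each real $\alpha\ge 0$, $\phi(\alpha r)=\alpha\phi(r)$. Independence of a future income: if $j\in\mathbb{Z}$ and $r,r'\in L^1_+$ satisfy $r_i=r'_i$ for each $i\in\mathbb{Z}\setminus\{j\}$, then $\phi_i(r)=\phi_i(r')$ for each $i<j$. Consistency: given $\phi$, $r\in L^1_+$ and $j\in\mathbb{Z}$, define the stream $r^j:\mathbb{Z}\to\mathbb{R}$ by $r^j_i=r_i$ if $i>j$; $r^j_j=r_j+\sum_{i<j}(r_i-\phi_i(r))$;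 $r^j_i=0$ if $i<j$. The axiom requires that for each $r\in L^1_+$ and each $j\in\mathbb{Z}$ such that $r^j\in L^1_+$, one has $\phi_i(r)=\phi_i(r^j)$ for each $i\ge j$. Continuity: whenever $r\in L^1_+$ and $(r^m)_{m\ge 0}$ is a sequence in $L^1_+$ with $\sum_{i\in\mathbb{Z}}|r^m_i-r_i|\to 0$ as $m\to\infty$, then $\sum_{i\in\mathbb{Z}}|\phi_i(r^m)-\phi_i(r)|\to 0$ as $m\to\infty$. *)

(* Defs.v *)
From HB Require Import structures.
From mathcomp Require Import all_boot all_order all_algebra.
From mathcomp Require Import all_classical all_reals all_analysis.

Set Implicit Arguments.
Unset Strict Implicit.
Unset Printing Implicit Defensive.

Import Order.TTheory GRing.Theory Num.Theory.
Import numFieldNormedType.Exports.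

Local Open Scope classical_set_scope.
Local Open Scope ring_scope.

Definition L1 (R : realType) : set (int -> R) :=
  [set r | summable [set: int] (EFin \o r)].

Arguments L1 R : clear implicits.

Definition L1plus (R : realType) : set (int -> R) :=
  L1 R `&` [set r | forall i, 0 <= r i].

Arguments L1plus R : clear implicits.

Section Streams.
Variable R : realType.
Local Notation L1plus := (L1plus R).

Lemma L1plus_scale (a : R) (r : L1plus) :
  0 <= a -> a \*o \val r \in L1plus.
Proof.
move=> a0; have /set_mem [rs r0] := valP r.
apply/mem_set; split => [|i /=]; last exact: mulr_ge0 (r0 i).
have le : (\esum_(i in [set: int]) `|(EFin \o (a \*o \val r)) i| <=
           a%:E * \esum_(i in [set: int]) `|(EFin \o \val r) i|)%E.
  apply: ge_ereal_sup => _ [X [finX XI] <-].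
  rewrite (eq_fsbigr (fun i => a%:E * `|(EFin \o \val r) i|)%E); last first.
    by move=> i _ /=; rewrite normrM ger0_norm.
  rewrite -ge0_mule_fsumr//; apply: lee_wpmul2l => //.
  by apply: ereal_sup_ubound; exists X.
apply: le_lt_trans le _; apply: lte_mul_pinfty => //.
Qed.

Definition scale (a : R) (a0 : 0 <= a) (r : L1plus) : L1plus :=
  SigSub (L1plus_scale r a0).

Implicit Type phi : L1plus -> L1plus.

Definition feasible phi := forall r : L1plus,
  (\esum_(i in [set: int]) (\val (phi r) i)%:E <=
   \esum_(i in [set: int]) (\val r i)%:E)%E.

Definition scale_invariant phi :=
  forall (r : L1plus) (a : R) (a0 : 0 <= a),
    phi (scale a0 r) = scale a0 (phi r).

Definition future_independent phi :=
  forall (j : int) (r r' : L1plus),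
    (forall i : int, i != j -> \val r i = \val r' i) ->
    forall i : int, i < j -> \val (phi r) i = \val (phi r') i.

(* [esum] is the usual sum only for nonnegative terms.  A family summable on
   [D] whose terms may change sign is summed as the (finite) sum of its positive
   parts minus the (finite) sum of its negative parts; outside that case the
   value is meaningless. *)
Definition signed_sum (D : set int) (f : int -> R) : R :=
  fine (esum D (EFin \o f)^\+%E) - fine (esum D (EFin \o f)^\-%E).

Definition residual phi (r : L1plus) (j : int) : int -> R := fun i =>
  if i < j then 0
  else if i == j then
    \val r j + signed_sum [set k : int | k < j]
                  (fun k => \val r k - \val (phi r) k)
  else \val r i.

Definition consistent phi :=
  forall (r : L1plus) (j : int) (rj : residual phi r j \in L1plus) (i : int),
    j <= i -> \val (phi r) i = \val (phi (SigSub rj)) i.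

Definition l1_dist (r r' : int -> R) : \bar R :=
  \esum_(i in [set: int]) `|r i - r' i|%:E.

Definition l1_continuous phi :=
  forall (r : L1plus) (rm : nat -> L1plus),
    l1_dist (\val (rm m)) (\val r) @[m --> \oo] --> 0%E ->
    l1_dist (\val (phi (rm m))) (\val (phi r)) @[m --> \oo] --> 0%E.

(* For j <= i the product runs over k = j, ..., i - 1, written k = j + n. *)
Definition geometric_rule phi :=
  exists lam : int -> R, (forall i, 0 <= lam i <= 1) /\
    forall (r : L1plus) (i : int),
      \val (phi r) i = lam i *
        fine (\esum_(j in [set j : int | j <= i])
          ((\prod_(n < `|i - j|%N) (1 - lam (j + n%:Z))) * \val r j)%:E).

End Streams.

(* Main.v *)
(** Let [c_i = sum_{j <= i} prod_{j <= k < i} (1 - lam_k) r_j] be the amount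
available at date [i], so that the geometric rule is [lam_i c_i] and
[c_(i+1) = r_(i+1) + (1 - lam_i) c_i].

For a geometric rule, the defect in
[sum_{k <= i} r_k = sum_{k <= i} lam_k c_k + (1 - lam_i) c_i] is constant in [i]
by the recurrence and tends to 0 at minus infinity.  This balance gives
feasibility and identifies [c_j] with the [j]-th income of the residual
stream, hence consistency.  Feasibility applied to [|r - r'|] shows that the
rule is nonexpansive in l1, hence continuous.

Conversely put [lam_j = phi_j(e_j)].  Future independence and continuity make
[phi_i(r)] depend only on the incomes up to [i], so scale invariance gives
[phi_a(r) = lam_a r_a] when [r] vanishes before [a].  Consistency then moves the
starting date from [a] to [a + 1], which proves the formula for streams bounded
below by induction, and continuity extends it to all streams. *)
Require Import Defs.
From mathcomp Require Import all_boot all_order all_algebra.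
From mathcomp Require Import all_classical all_reals all_analysis.
From mathcomp Require Import finmap zify lra.

Set Implicit Arguments.
Unset Strict Implicit.
Unset Printing Implicit Defensive.

Import Order.TTheory GRing.Theory Num.Theory.
Import numFieldNormedType.Exports.

Local Open Scope classical_set_scope.
Local Open Scope ring_scope.

(** * Sums of nonnegative summable streams over sets of dates *)

Section StreamSums.
Variable R : realType.
Implicit Types (D : set int) (f g r s : int -> R) (lam : int -> R).

(** A real-valued sum, open to linear arithmetic; by [csumK], [fine] loses nothing on [L1plus]. *)
Definition csum D f : R := fine (\esum_(i in D) (f i)%:E).

Lemma L1plus_ge0 f i : L1plus R f -> 0 <= f i.
Proof. by move=> [_]; exact. Qed.

Lemma L1plusP f :
  (forall i, 0 <= f i) -> (\esum_(i in setT) (f i)%:E < +oo)%E -> L1plus R f.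
Proof.
move=> f0 fs; split=> //; rewrite /L1 /summable /=.
by under eq_esum do rewrite /= ger0_norm//.
Qed.

Lemma csumK D f : L1plus R f -> (csum D f)%:E = \esum_(i in D) (f i)%:E.
Proof.
move=> fL; rewrite /csum fineK// ge0_fin_numE; last first.
  by apply: esum_ge0 => i _; rewrite lee_fin L1plus_ge0.
case: fL => fs f0; apply: le_lt_trans fs; rewrite esum_mkcond.
by apply: le_esum => i _ /=; case: ifP => _; rewrite lee_fin ?ler_norm.
Qed.

Lemma csum_ge0 D f : L1plus R f -> 0 <= csum D f.
Proof.
move=> fL; rewrite -lee_fin csumK//.
by apply: esum_ge0 => i _; rewrite lee_fin L1plus_ge0.
Qed.

Lemma L1plus_le f g :
  L1plus R g -> (forall i, 0 <= f i <= g i) -> L1plus R f.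
Proof.
move=> gL fg; apply: L1plusP => [i|]; first by case/andP: (fg i).
apply: (@le_lt_trans _ _ (csum setT g)%:E); last exact: ltry.
by rewrite csumK//; apply: le_esum => i _; rewrite lee_fin; case/andP: (fg i).
Qed.

Lemma L1plusD f g : L1plus R f -> L1plus R g -> L1plus R (f \+ g).
Proof.
move=> fL gL; apply: L1plusP => [i /=|].
  by rewrite addr_ge0// L1plus_ge0.
under eq_esum do rewrite /= EFinD.
rewrite esumD => [|i _|i _]; rewrite ?lee_fin ?L1plus_ge0//.
by rewrite -!csumK// -EFinD ltry.
Qed.

Lemma L1plusZ (a : R) f : 0 <= a -> L1plus R f -> L1plus R (a \*o f).
Proof.
by move=> a0 fL; have /set_mem := L1plus_scale (SigSub (mem_set fL)) a0.
Qed.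

Lemma eq_csum D f g : (forall i, D i -> f i = g i) -> csum D f = csum D g.
Proof. by move=> fg; congr fine; apply: eq_esum => i Di; rewrite fg. Qed.

Lemma csumD D f g : L1plus R f -> L1plus R g ->
  csum D (f \+ g) = csum D f + csum D g.
Proof.
move=> fL gL; apply: EFin_inj; rewrite EFinD !csumK//; last exact: L1plusD.
by rewrite -esumD// => i _; rewrite lee_fin L1plus_ge0.
Qed.

Lemma csumZ D (a : R) f : 0 <= a -> L1plus R f ->
  csum D (a \*o f) = a * csum D f.
Proof.
move=> a0 fL; apply: EFin_inj; rewrite EFinM !csumK//; last exact: L1plusZ.
rewrite /esum -ereal_supZl//; last first.
  by apply/set0P; exists 0%E, set0; rewrite ?fsbig_set0//; exact: fsets_set0.
congr ereal_sup; rewrite image_comp; apply: eq_imagel => X [finX _] /=.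
by rewrite ge0_mule_fsumr// => i; rewrite lee_fin L1plus_ge0.
Qed.

Lemma L1plus_dist f g : L1plus R f -> L1plus R g ->
  L1plus R (fun i => `|f i - g i|).
Proof.
move=> fL gL; apply: (L1plus_le (L1plusD fL gL)) => i /=.
have := L1plus_ge0 i fL; have := L1plus_ge0 i gL.
by rewrite normr_ge0 ler_norml; lra.
Qed.

Lemma le_csum D f g : L1plus R f -> L1plus R g ->
  (forall i, D i -> f i <= g i) -> csum D f <= csum D g.
Proof.
move=> fL gL fg; rewrite -lee_fin !csumK//; apply: le_esum => i Di.
by rewrite lee_fin fg.
Qed.

Lemma csumID D D' f : L1plus R f ->
  csum D f = csum (D `&` D') f + csum (D `&` ~` D') f.
Proof.
move=> fL; apply: EFin_inj; rewrite EFinD !csumK// (esumID D')// => i _.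
by rewrite lee_fin L1plus_ge0.
Qed.

Lemma csum_subset D D' f : L1plus R f -> D `<=` D' -> csum D f <= csum D' f.
Proof.
move=> fL DD'; rewrite (csumID D' D)// setIidr// lerDl.
exact: csum_ge0.
Qed.

Lemma csum1 k f : L1plus R f -> csum [set k] f = f k.
Proof. by move=> fL; rewrite /csum esum_set1// lee_fin L1plus_ge0. Qed.

Lemma csum_eq0 D f : (forall i, D i -> f i = 0) -> csum D f = 0.
Proof. by move=> f0; rewrite /csum esum1// => i Di; rewrite f0. Qed.

Lemma le_csum1 D f k : L1plus R f -> D k -> f k <= csum D f.
Proof.
by move=> fL Dk; rewrite -(csum1 k fL); apply: csum_subset => // _ ->.
Qed.

(** Every finite set of dates lies below some date, so each finite partial sum is at most a prefix
    sum. *)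
Lemma csum_le_finite (c : R) f : L1plus R f ->
  (forall i, csum [set k | k <= i] f <= c) -> csum setT f <= c.
Proof.
move=> fL fc; rewrite -lee_fin csumK//.
apply: ge_ereal_sup => _ [X [finX _] <-].
have [i Xi] : exists i : int, X `<=` [set k | k <= i].
  move: finX => /finite_seqP[l ->]; elim: l => [|k l [i li]]; first by exists 0.
  exists (Num.max k i) => j; rewrite /= inE le_max => /orP[/eqP->|/li ->].
    by rewrite lexx.
  by rewrite orbT.
apply: le_trans (_ : (csum [set k | k <= i] f)%:E <= _)%E; last first.
  by rewrite lee_fin.
by rewrite csumK//; apply: ereal_sup_ubound; exists X.
Qed.

(** Dominated convergence: a finite set [X] carries all of the sum of [g] but less than [e].
    Eventually [u m] vanishes on all of [X], and outside [X] it is dominated by [g]. *)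
Lemma csum_dominated (u : nat -> int -> R) g : L1plus R g ->
  (forall m i, 0 <= u m i <= g i) ->
  (forall i, \forall m \near \oo, u m i = 0) ->
  csum setT (u m) @[m --> \oo] --> (0 : R).
Proof.
move=> gL ug u0.
have uL m : L1plus R (u m) by apply: L1plus_le (ug m).
apply/cvgrPdist_lt => e e0.
have : ((csum setT g - e)%:E < \esum_(i in setT) (g i)%:E)%E.
  by rewrite -csumK// lte_fin ltrBlDr ltrDl.
move=> /ereal_sup_gt[_ [X [finX _] <-] eX].
have XE : (\sum_(i \in X) (g i)%:E = (csum X g)%:E)%E.
  by rewrite csumK// esum_fset// => i _; rewrite lee_fin L1plus_ge0.
rewrite XE lte_fin in eX.
have : \forall m \near \oo,
    (\bigcap_(i in [set` fset_set X]) [set m | u m i = 0]) m.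
  by apply: filter_bigI => i _; exact: u0.
apply: filterS => m uX; rewrite sub0r normrN ger0_norm ?csum_ge0//.
rewrite (csumID setT X)// !setTI csum_eq0; last first.
  by move=> i Xi; apply: uX; rewrite /= in_fset_set//; exact: mem_set.
rewrite add0r; have : csum (~` X) (u m) <= csum (~` X) g.
  by apply: le_csum => // i _; case/andP: (ug m i).
have := csumID setT X gL; rewrite !setTI; lra.
Qed.

Lemma csum_leS i f : L1plus R f ->
  csum [set k | k <= i + 1] f = f (i + 1) + csum [set k | k <= i] f.
Proof.
move=> fL; rewrite (csumID _ [set i + 1])//; congr (_ + _).
  rewrite -(csum1 (i + 1) fL); congr csum.
  by apply/seteqP; split=> k /=; [case|move=> ->; split].
congr csum; apply/seteqP; split=> k /=; lia.
Qed.

Lemma csum_tail_cvg f i : L1plus R f ->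
  csum [set k | k <= i - m%:Z] f @[m --> \oo] --> (0 : R).
Proof.
move=> fL.
have E m : csum [set k | k <= i - m%:Z] f =
    csum setT (fun k => if k <= i - m%:Z then f k else 0).
  rewrite /csum esum_mkcond; congr fine; apply: eq_esum => k _.
  case: ifPn => [/set_mem/= ->//|/negP kD].
  by rewrite ifF//; apply/negP => ki; apply: kD; exact: mem_set.
under eq_fun do rewrite E; apply: (csum_dominated fL) => [m k|k].
  by case: ifP; rewrite lexx (L1plus_ge0 k fL).
(* The successor makes [i - m < k] strict, so that date [k] is cut off. *)
exists (`|i - k|%N.+1) => // m /= mk; rewrite ifF//; lia.
Qed.

End StreamSums.

(** * Weights and the amount available at each date *)

Section Carry.
Variables (R : realType) (lam : int -> R).
Hypothesis lam01 : forall i, 0 <= lam i <= 1.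
Implicit Types (r s : int -> R).

Definition weight (i j : int) : R :=
  \prod_(n < `|i - j|%N) (1 - lam (j + n%:Z)).

Definition carry r (i : int) : R :=
  csum [set j | j <= i] (fun j => weight i j * r j).

(** For [i < j] the product has no meaning for the rule, yet its factors still lie in [0, 1]. Hence
    the weighted stream is dominated by [r] at all dates. *)
Lemma weight01 i j : 0 <= weight i j <= 1.
Proof.
apply/andP; split.
  by apply: prodr_ge0 => n _; have := lam01 (j + n%:Z); lra.
by apply: prodr_ile1 => n _; have := lam01 (j + n%:Z); lra.
Qed.

Lemma weightii i : weight i i = 1.
Proof. by rewrite /weight subrr big_ord0. Qed.

Lemma weightS (i j : int) :
  j <= i -> weight (i + 1) j = (1 - lam i) * weight i j.
Proof.
move=> ji.
rewrite /weight (_ : `|(i + 1)%R - j|%N = `|i - j|%N.+1); last by lia.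
rewrite big_ord_recr /= mulrC; congr ((1 - lam _) * _); lia.
Qed.

Lemma weight_le i r j : L1plus R r -> 0 <= weight i j * r j <= r j.
Proof.
move=> rL; have /andP[w0 w1] := weight01 i j; have r0 := L1plus_ge0 j rL.
by rewrite mulr_ge0//= ler_piMl.
Qed.

Lemma L1plus_weight i r : L1plus R r -> L1plus R (fun j => weight i j * r j).
Proof. by move=> rL; apply: (L1plus_le rL) => j; exact: weight_le. Qed.

Lemma carry_ge0 r i : L1plus R r -> 0 <= carry r i.
Proof. by move=> rL; apply/csum_ge0/L1plus_weight. Qed.

Lemma carry_le r i : L1plus R r -> carry r i <= csum [set j | j <= i] r.
Proof.
move=> rL; apply: le_csum => // [|j _]; first exact: L1plus_weight.
by case/andP: (weight_le i j rL).
Qed.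

Lemma carryS r i : L1plus R r ->
  carry r (i + 1) = r (i + 1) + (1 - lam i) * carry r i.
Proof.
move=> rL; rewrite /carry csum_leS; last exact: L1plus_weight.
rewrite weightii mul1r; congr (_ + _).
have -> : csum [set k | k <= i] (fun j => weight (i + 1) j * r j) =
    csum [set k | k <= i] ((1 - lam i) \*o (fun j => weight i j * r j)).
  by apply: eq_csum => j /= ji; rewrite weightS// mulrA.
rewrite csumZ//; last exact: L1plus_weight.
by have := lam01 i; lra.
Qed.

Lemma eq_carry r s i : (forall j, j <= i -> r j = s j) ->
  carry r i = carry s i.
Proof. by move=> rs; apply: eq_csum => j /= /rs ->. Qed.

Lemma carryZ a r i : 0 <= a -> L1plus R r ->
  carry (a \*o r) i = a * carry r i.
Proof.
move=> a0 rL; rewrite -csumZ//; last exact: L1plus_weight.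
by apply: eq_csum => j _ /=; rewrite mulrCA.
Qed.

Lemma carryD r s i : L1plus R r -> L1plus R s ->
  carry (r \+ s) i = carry r i + carry s i.
Proof.
move=> rL sL; rewrite -csumD; [|exact: L1plus_weight|exact: L1plus_weight].
by apply: eq_csum => j _ /=; rewrite mulrDr.
Qed.

Lemma carry_mono r s i : L1plus R r -> L1plus R s ->
  (forall j, r j <= s j) -> carry r i <= carry s i.
Proof.
move=> rL sL rs; apply: le_csum => [||j _]; [exact: L1plus_weight..|].
by rewrite ler_wpM2l//; case/andP: (weight01 i j).
Qed.

(** [carry] is monotone and additive; apply this to [r <= s + |r - s|] and [s <= r + |r - s|]. *)
Lemma carry_dist r s i : L1plus R r -> L1plus R s ->
  `|carry r i - carry s i| <= carry (fun j => `|r j - s j|) i.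
Proof.
move=> rL sL; have dL := L1plus_dist rL sL.
have : carry r i <= carry (s \+ (fun j => `|r j - s j|)) i.
  apply: carry_mono => // [|j /=]; first exact: L1plusD.
  by have := ler_norm (r j - s j); lra.
have : carry s i <= carry (r \+ (fun j => `|r j - s j|)) i.
  apply: carry_mono => // [|j /=]; first exact: L1plusD.
  by have := lerNnormlW (lexx `|r j - s j|); lra.
by rewrite !carryD// ler_norml; lra.
Qed.

Lemma carry_bottom r i : L1plus R r -> (forall j, j < i -> r j = 0) ->
  carry r i = r i.
Proof.
move=> rL r0; rewrite -[i](subrK 1) carryS//.
rewrite /carry csum_eq0 ?mulr0 ?addr0// => j /= ji.
by rewrite r0 ?mulr0//; lia.
Qed.

(* The difference of the two sides does not depend on [i] and vanishes as
   [i] tends to minus infinity. *)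
Lemma carry_balance r i :
  L1plus R r -> L1plus R (fun k => lam k * carry r k) ->
  csum [set k | k <= i] r =
  csum [set k | k <= i] (fun k => lam k * carry r k) + (1 - lam i) * carry r i.
Proof.
move=> rL sL; set s := (fun k : int => lam k * carry r k).
pose d k := csum [set j | j <= k] r -
  (csum [set j | j <= k] s + (1 - lam k) * carry r k).
have dS k : d (k + 1) = d k.
  rewrite /d !csum_leS// [s (k + 1)]/s.
  move: (csum _ r) (csum _ s) (carryS k rL) => A B.
  by lra.
have dE m : d (i - m%:Z) = d i.
  elim: m => [|m <-]; first by rewrite subr0.
  by rewrite -[LHS]dS; congr d; lia.
suff : `|d i| <= 0 by rewrite normr_le0 subr_eq0 => /eqP.
(* Since [0 <= (1 - lam k) * carry r k <= carry r k], which is at most the prefix sum of [r], the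
   defect at [k] lies between minus the prefix sum of [s] and the prefix sum of [r]. *)
have b m : `|d i| <=
    csum [set k | k <= i - m%:Z] r + csum [set k | k <= i - m%:Z] s.
  rewrite -(dE m) /d; move: (i - m%:Z) => k.
  have := carry_le k rL; have := carry_ge0 k rL; have /andP[l0 l1] := lam01 k.
  have := @csum_ge0 _ [set j | j <= k] _ rL.
  have := @csum_ge0 _ [set j | j <= k] _ sL.
  by rewrite ler_norml; nra.
rewrite -[leRHS]addr0; apply: (@cvgr_to_ge _ \oo).
  apply: cvgD; [exact: (csum_tail_cvg i rL)|exact: (csum_tail_cvg i sL)].
exact: nearW.
Qed.

End Carry.

(** * Residual streams and the l1 distance *)

Section Residual.
Variable R : realType.
Implicit Types (f g : int -> R) (r : L1plus R) (phi : L1plus R -> L1plus R).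

Lemma L1plus_val r : L1plus R (\val r).
Proof. exact: set_mem (valP r). Qed.

Lemma L1plus_summable D f : L1plus R f -> summable D (EFin \o f).
Proof.
move=> fL; rewrite /summable.
under eq_esum do rewrite /= ger0_norm ?(L1plus_ge0 _ fL)//.
by rewrite -csumK// ltry.
Qed.

(** The positive and negative parts of a summable difference have finite sums, so [fine] commutes
    with their subtraction and [esumB] applies. *)
Lemma signed_sumB D f g : L1plus R f -> L1plus R g ->
  signed_sum D (fun k => f k - g k) = csum D f - csum D g.
Proof.
move=> fL gL; have fS := L1plus_summable D fL; have gS := L1plus_summable D gL.
have fin (h : int -> \bar R) : (forall i, 0 <= h i)%E -> summable D h ->
    esum D h \is a fin_num.
  move=> h0; rewrite summableE; congr (_ \is a fin_num).
  by apply: eq_esum => i _; rewrite gee0_abs.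
rewrite /signed_sum.
have -> : EFin \o (fun k => f k - g k) = ((EFin \o f) \- (EFin \o g))%E by [].
rewrite -fineB.
- rewrite (esumB fS gS); first by rewrite -!csumK// EFinB.
  + by move=> i _; rewrite lee_fin L1plus_ge0.
  + by move=> i _; rewrite lee_fin L1plus_ge0.
- by apply: fin => //; exact/summable_funepos/summableB.
- by apply: fin => //; exact/summable_funeneg/summableB.
Qed.

Lemma residual_at phi r (j : int) : residual phi r (j + 1) (j + 1) =
  \val r (j + 1) +
    (csum [set k | k <= j] (\val r) - csum [set k | k <= j] (\val (phi r))).
Proof.
rewrite /residual ltxx eqxx; congr (_ + _).
have -> : [set k : int | k < j + 1] = [set k | k <= j].
  by apply/seteqP; split=> k /=; lia.
by rewrite signed_sumB//; exact: L1plus_val.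
Qed.

Lemma residual_lt phi r (j k : int) : k < j -> residual phi r j k = 0.
Proof. by rewrite /residual => ->. Qed.

Lemma residual_gt phi r (j k : int) : j < k -> residual phi r j k = \val r k.
Proof. by move=> jk; rewrite /residual !ifF//; lia. Qed.

(** After [j] both streams have the same incomes, hence the same recurrence. At [j] the residual
    stream has no past, so its carry is its own income there. *)
Lemma carry_residual (lam : int -> R) phi r (j i : int) :
  (forall k, 0 <= lam k <= 1) -> L1plus R (residual phi r j) ->
  residual phi r j j = carry lam (\val r) j -> j <= i ->
  carry lam (residual phi r j) i = carry lam (\val r) i.
Proof.
move=> lam01 sL sj ji; have -> : i = j + `|i - j|%N%:Z by lia.
elim: `|_|%N => [|n IH].
  by rewrite addr0 carry_bottom// => k; exact: residual_lt.
rewrite (_ : j + n.+1%:Z = j + n%:Z + 1); last by lia.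
rewrite !carryS//; last exact: L1plus_val.
by rewrite IH residual_gt//; lia.
Qed.

Lemma l1_distE f g : L1plus R f -> L1plus R g ->
  l1_dist f g = (csum setT (fun i => `|f i - g i|))%:E.
Proof. by move=> fL gL; rewrite csumK//; exact: L1plus_dist. Qed.

Lemma le_l1_dist f g i : L1plus R f -> L1plus R g ->
  (`|f i - g i|%:E <= l1_dist f g)%E.
Proof.
move=> fL gL; rewrite l1_distE// lee_fin.
by apply: (@le_csum1 _ _ (fun i => `|f i - g i|)) => //; exact: L1plus_dist.
Qed.

(** Serves two approximations of a stream: one replaces its far future, the other cuts off its
    distant past. *)
Lemma l1_dist_cvg0 (u : nat -> int -> R) f g :
  (forall m, L1plus R (u m)) -> L1plus R f -> L1plus R g ->
  (forall m i, `|u m i - f i| <= g i) ->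
  (forall i, \forall m \near \oo, u m i = f i) ->
  l1_dist (u m) f @[m --> \oo] --> 0%E.
Proof.
move=> uL fL gL ug uf; apply/fine_cvgP; split.
  by apply: nearW => m; rewrite l1_distE.
under eq_fun do rewrite /= l1_distE//=.
apply: (csum_dominated gL) => [m i|i]; first by rewrite normr_ge0 ug.
by move: (uf i); apply: filterS => m ->; rewrite subrr normr0.
Qed.

End Residual.

(** * Geometric rules satisfy the axioms *)

Section GeometricRuleAxioms.
Variables (R : realType) (phi : L1plus R -> L1plus R) (lam : int -> R).
Hypothesis lam01 : forall i, 0 <= lam i <= 1.
Hypothesis phiE :
  forall r i, \val (phi r) i = lam i * carry lam (\val r) i.
Implicit Type r : L1plus R.

Lemma geometric_balance r i : csum [set k | k <= i] (\val r) =
  csum [set k | k <= i] (\val (phi r)) + (1 - lam i) * carry lam (\val r) i.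
Proof.
have E : \val (phi r) = fun k => lam k * carry lam (\val r) k.
  by apply/funext => k; exact: phiE.
rewrite E; apply: carry_balance => //; first exact: L1plus_val.
by rewrite -E; exact: L1plus_val.
Qed.

Lemma geometric_csum_le r : csum setT (\val (phi r)) <= csum setT (\val r).
Proof.
apply: csum_le_finite => [|i]; first exact: L1plus_val.
apply: le_trans (_ : csum [set k | k <= i] (\val r) <= _).
  rewrite (geometric_balance r) lerDl mulr_ge0//.
    by have := lam01 i; lra.
  by apply: carry_ge0 => //; exact: L1plus_val.
by apply: csum_subset => //; exact: L1plus_val.
Qed.

Lemma geometric_feasible : feasible phi.
Proof.
move=> r; rewrite -!csumK ?lee_fin; [|exact: L1plus_val..].
exact: geometric_csum_le.
Qed.

Lemma geometric_scale_invariant : scale_invariant phi.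
Proof.
move=> r a a0; apply/val_inj/funext => i.
rewrite phiE /= carryZ//; last exact: L1plus_val.
by rewrite phiE mulrCA.
Qed.

Lemma geometric_future_independent : future_independent phi.
Proof.
move=> j r r' rr' i ij; rewrite !phiE; congr (_ * _).
by apply: eq_carry => k ki; apply: rr'; lia.
Qed.

Lemma geometric_consistent : consistent phi.
Proof.
move=> r j rj i ji; rewrite !phiE /=; congr (_ * _); symmetry.
apply: carry_residual => //; first exact: set_mem.
(* By the balance at [j - 1], the income left unallocated before [j] is [(1 - lam (j - 1)) * carry]
   at [j - 1], exactly the term that the recurrence adds to the income at [j]. *)
rewrite -[j](subrK 1) residual_at geometric_balance carryS//.
  by congr (_ + _); rewrite addrAC subrr add0r.
exact: L1plus_val.
Qed.

Lemma geometric_nonexpansive r r' :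
  (l1_dist (\val (phi r)) (\val (phi r')) <= l1_dist (\val r) (\val r'))%E.
Proof.
have [rL r'L] := (L1plus_val r, L1plus_val r').
pose d : L1plus R := SigSub (mem_set (L1plus_dist rL r'L)).
rewrite !l1_distE ?lee_fin//; [|exact: L1plus_val..].
apply: le_trans (geometric_csum_le d).
apply: le_csum => [||i _].
- by apply: L1plus_dist; exact: L1plus_val.
- exact: L1plus_val.
have /andP[l0 _] := lam01 i.
rewrite !phiE -mulrBr normrM ger0_norm// ler_wpM2l//.
exact: carry_dist.
Qed.

Lemma geometric_continuous : l1_continuous phi.
Proof.
move=> r rm rmr; apply: squeeze_cvge rmr; last exact: cvg_cst.
apply: nearW => m; rewrite geometric_nonexpansive andbT.
by apply: esum_ge0.
Qed.

End GeometricRuleAxioms.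

(** * Streams with a single income *)

Section SingleIncome.
Variable R : realType.

Definition single (c : R) (j : int) : int -> R :=
  fun k => if k == j then c else 0.

Lemma L1plus_single c j : 0 <= c -> L1plus R (single c j).
Proof.
move=> c0; apply: L1plusP => [i|]; first by rewrite /single; case: ifP.
rewrite (esumID [set j]) => [|i _]; last by rewrite lee_fin /single; case: ifP.
rewrite setTI esum_set1 /single ?eqxx ?lee_fin//.
rewrite esum1 ?adde0 ?ltry// => i [_ /= ij].
by rewrite ifF//; apply/eqP.
Qed.

Lemma csum_single c j : 0 <= c -> csum setT (single c j) = c.
Proof.
move=> c0; have sL := L1plus_single j c0.
rewrite (csumID _ [set j])// setTI csum1// csum_eq0 => [|i [_ /= ij]].
  by rewrite /single eqxx addr0.
by rewrite /single ifF//; apply/eqP.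
Qed.

End SingleIncome.

(** * The axioms force a geometric rule *)

Section AxiomsGeometric.
Variables (R : realType) (phi : L1plus R -> L1plus R).
Implicit Types r s : L1plus R.

(** Future independence changes one income at a time, hence finitely many; continuity passes to the
    infinitely many dates after [i]. *)
Lemma future_independent_prefix : future_independent phi -> l1_continuous phi ->
  forall (i : int) r s, (forall k, k <= i -> \val r k = \val s k) ->
  \val (phi r) i = \val (phi s) i.
Proof.
move=> phiF phiC i r s rs; have [rL sL] := (L1plus_val r, L1plus_val s).
(* [f m] is reached from [s] by changing the [m] incomes after date [i] only. *)
pose f (m : nat) (k : int) := if k <= i + m%:Z then \val r k else \val s k.
have fL m : L1plus R (f m).
  apply: (L1plus_le (L1plusD rL sL)) => k /=; rewrite /f.
  have r0 := L1plus_ge0 k rL; have s0 := L1plus_ge0 k sL.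
  by case: ifP => _; rewrite ?r0 ?s0 ?lerDl ?lerDr.
pose rm m : L1plus R := SigSub (mem_set (fL m)).
have phirm m : \val (phi (rm m)) i = \val (phi s) i.
  elim: m => [|m <-].
    congr (\val (phi _) i); apply/val_inj/funext => k.
    by rewrite /= /f addr0; case: ifP => // /rs.
  apply: (phiF (i + m.+1%:Z)) => [k km|]; last by lia.
  by rewrite /= /f; congr (if _ then _ else _); lia.
have dphi : l1_dist (\val (phi (rm m))) (\val (phi r)) @[m --> \oo] --> 0%E.
  apply: phiC.
  apply: (@l1_dist_cvg0 _ _ _ (fun k => `|\val s k - \val r k|)) => //.
  - exact: L1plus_dist.
  - by move=> m k; rewrite /= /f; case: ifP => // _; rewrite subrr normr0.
  - move=> k; exists `|k - i|%N => // m /= km.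
    by rewrite /f ifT//; lia.
apply/esym/eqP; rewrite -subr_eq0 -normr_le0 -lee_fin.
apply: cvge_ge dphi; apply: nearW => m; rewrite -(phirm m).
by apply: le_l1_dist; exact: L1plus_val.
Qed.

Hypotheses (phiFeas : feasible phi) (phiS : scale_invariant phi).
Hypotheses (phiF : future_independent phi) (phiCons : consistent phi).
Hypothesis phiC : l1_continuous phi.

Definition unit_income (j : int) : L1plus R :=
  SigSub (mem_set (L1plus_single j (@ler01 R))).

Definition rate (j : int) : R := \val (phi (unit_income j)) j.

Lemma rate01 j : 0 <= rate j <= 1.
Proof.
have uL := L1plus_val (phi (unit_income j)).
rewrite /rate (L1plus_ge0 j uL) /=.
apply: le_trans (le_csum1 uL (I : setT j)) _.
rewrite -(csum_single j (@ler01 R)) -lee_fin !csumK//; exact: L1plus_single.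
Qed.

Lemma phi_below r (a i : int) :
  (forall k, k < a -> \val r k = 0) -> i < a -> \val (phi r) i = 0.
Proof.
(* Up to [i] the stream agrees with [0 * r], whose allocation is zero by scale invariance. *)
move=> r0 ia; rewrite (@future_independent_prefix _ _ i r (scale (lexx 0) r))//.
  by rewrite phiS /= mul0r.
by move=> k ki /=; rewrite r0 ?mulr0//; lia.
Qed.

Lemma phi_first r (a : int) :
  (forall k, k < a -> \val r k = 0) -> \val (phi r) a = rate a * \val r a.
Proof.
move=> r0; have ra0 := L1plus_ge0 a (L1plus_val r).
(* Up to [a] the stream is [r a] times the unit income at [a]. *)
rewrite (@future_independent_prefix _ _ a r (scale ra0 (unit_income a)))//.
  by rewrite phiS /= mulrC.
move=> k ka /=; rewrite /single.
case: eqP => [->|/eqP ?]; first by rewrite mulr1.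
by rewrite mulr0 r0//; lia.
Qed.

(** Induction on the distance [n] from the starting date, for all [a] and [r]: the residual stream
    at [a + 1] starts one date later, and consistency carries its allocation back to [r]. *)
Lemma phi_bounded_below (n : nat) (a : int) r :
  (forall k, k < a -> \val r k = 0) ->
  \val (phi r) (a + n%:Z) = rate (a + n%:Z) * carry rate (\val r) (a + n%:Z).
Proof.
elim: n a r => [|n IH] a r r0; have rL := L1plus_val r.
  by rewrite addr0 phi_first// carry_bottom//; exact: rate01.
have csum_at f : L1plus R f -> (forall k, k < a -> f k = 0) ->
    csum [set k | k <= a] f = f a.
  move=> fL f0; rewrite -[a](subrK 1) csum_leS// csum_eq0 ?addr0// => k /= ka.
  by rewrite f0//; lia.
have carryE : residual phi r (a + 1) (a + 1) = carry rate (\val r) (a + 1).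
  rewrite residual_at carryS//; last exact: rate01.
  rewrite carry_bottom//; last exact: rate01.
  rewrite !csum_at//; first by rewrite phi_first//; lra.
  + exact: L1plus_val.
  + by move=> k; exact: phi_below.
(* Consistency speaks only of residual streams in [L1plus]. This one exceeds [r] at most at [a + 1],
   so [r] plus a single income there dominates it. *)
have resL : L1plus R (residual phi r (a + 1)).
  have c0 : 0 <= carry rate (\val r) (a + 1).
    by apply: carry_ge0 => //; exact: rate01.
  apply: (L1plus_le (L1plusD rL (L1plus_single (a + 1) c0))) => k /=.
  have rk0 := L1plus_ge0 k rL; rewrite /single.
  have [ka|ka|->] := ltgtP k (a + 1).
  - by rewrite residual_lt//= addr0 lexx.
  - by rewrite residual_gt//= addr0 rk0 lexx.
  - by rewrite carryE c0 lerDr L1plus_ge0.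
rewrite (_ : a + n.+1%:Z = a + 1 + n%:Z); last by lia.
rewrite (phiCons (mem_set resL)); last by lia.
rewrite IH /=; last by move=> k; exact: residual_lt.
by rewrite carry_residual//; [exact: rate01|lia].
Qed.

Lemma axioms_geometric r i : \val (phi r) i = rate i * carry rate (\val r) i.
Proof.
have rL := L1plus_val r.
pose f (m : nat) (k : int) := if - m%:Z <= k then \val r k else 0.
have fL m : L1plus R (f m).
  apply: (L1plus_le rL) => k; rewrite /f.
  by have rk0 := L1plus_ge0 k rL; case: ifP; rewrite rk0 lexx.
pose rm m : L1plus R := SigSub (mem_set (fL m)).
have drm : l1_dist (\val (rm m)) (\val r) @[m --> \oo] --> 0%E.
  apply: (@l1_dist_cvg0 _ _ _ (\val r)) => //.
  - move=> m k; rewrite /= /f; have rk0 := L1plus_ge0 k rL.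
    by case: ifP; rewrite ?subrr ?normr0// sub0r normrN ger0_norm.
  - by move=> k; exists `|k|%N => // m /= km; rewrite /f ifT//; lia.
(* The sum of the two distances tends to 0 and will bound the gap between the two sides of the
   formula. *)
have /cvgeD /(_ drm) := phiC drm; rewrite adde0 => /(_ isT) dphi.
apply/eqP; rewrite -subr_eq0 -normr_le0 -lee_fin.
apply: cvge_ge dphi.
(* From here on the truncation starts at [-m <= i], so [i] is a natural number of dates after its
   start. *)
exists `|i|%N => // m /= im.
have E : \val (phi (rm m)) i = rate i * carry rate (f m) i.
  have -> : i = - m%:Z + `|(i + m%:Z)%R|%N%:Z by lia.
  by apply: phi_bounded_below => k km; rewrite /= /f ifF//; lia.
have d1 := le_l1_dist i (L1plus_val (phi (rm m))) (L1plus_val (phi r)).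
have d2 : (`|rate i * carry rate (f m) i - rate i * carry rate (\val r) i|%:E <=
    l1_dist (f m) (\val r))%E.
  rewrite l1_distE// lee_fin -mulrBr normrM.
  have /andP[l0 l1] := rate01 i; rewrite ger0_norm//.
  apply: le_trans (_ : carry rate (fun j => `|f m j - \val r j|) i <= _).
    apply: le_trans (ler_piMl _ l1) _ => //.
    by apply: carry_dist => //; exact: rate01.
  apply: le_trans (carry_le _ _ _) _; [exact: rate01|exact: L1plus_dist|].
  by apply: csum_subset => //; exact: L1plus_dist.
apply: le_trans (leeD d1 d2).
by rewrite -EFinD lee_fin E [X in _ <= X + _]distrC; exact: ler_distD.
Qed.

End AxiomsGeometric.

Theorem theorem1 (R : realType) (phi : L1plus R -> L1plus R) :
  (feasible phi /\ scale_invariant phi /\ future_independent phi /\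
   consistent phi /\ l1_continuous phi)
  <-> geometric_rule phi.
Proof.
split=> [[feas [scal [indep [cons cont]]]]|[lam [lam01 phiE]]].
  by exists (rate phi); split; [exact: rate01|exact: axioms_geometric].
split; first exact: geometric_feasible phiE.
split; first exact: geometric_scale_invariant phiE.
split; first exact: geometric_future_independent phiE.
by split; [exact: geometric_consistent phiE|exact: geometric_continuous phiE].
Qed.
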